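(* Let $p>2$ and $p'=\frac{p}{p-1}$. Let $b_j(p)=2\int_0^1\cos_p(\pi_p x)\cos(j\pi x)\,dx$. Then $$|b_j(p)|<\frac{2\pi_{p'}}{\pi^2(p-1)}\left[2+\frac{\pi^2}{2}(p-2)\right]j^{-p'}\qquad\text{for all integers } j\ge 3.$$
   Context: For $1<p<\infty$ let $F_p(y)=\int_0^y(1-t^p)^{-1/p}\,dt$ for $y\in[0,1]$, and $\pi_p:=2F_p(1)=\frac{2\pi}{p\sin(\pi/p)}$. The function $\sin_p:[0,\frac{\pi_p}{2}]\to[0,1]$ is the inverse of $F_p$, extended to $\mathbb{R}$ by $\sin_p(-x)=-\sin_p(x)$ and $\sin_p(\frac{\pi_p}{2}-x)=\sin_p(\frac{\pi_p}{2}+x)$ (so it is $2\pi_p$-periodic). Define $\cos_p x:=\frac{d}{dx}\sin_p x$ for all $x\in\mathbb{R}$. *)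

(* Defs.v *)
(* Generalized trigonometric functions sin_p and cos_p, in MathComp-Analysis. *)
From HB Require Import structures.
From mathcomp Require Import all_boot all_order all_algebra.
From mathcomp Require Import all_classical all_reals all_analysis.
From mathcomp Require Import measurable_realfun zify ring lra.
Set Implicit Arguments.
Unset Strict Implicit.
Unset Printing Implicit Defensive.
Import Order.TTheory GRing.Theory Num.Theory.
Import numFieldNormedType.Exports.
Local Open Scope classical_set_scope.
Local Open Scope ring_scope.

(* F_p. At y = 1 this is the improper integral: the Lebesgue integral of the
   nonnegative integrand over [0, 1], where the value 0 `^ (- p^-1) = 0 at the
   single point t = 1 is immaterial. Integrability is proved below. *)
Definition arcsinp (R : realType) (p y : R) : R :=
  \int[lebesgue_measure]_(t in `[0, y]) (1 - t `^ p) `^ (- p^-1).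

Definition pip (R : realType) (p : R) : R := 2 * arcsinp p 1.

(* The inverse of F_p on [0, pip p / 2], with values in [0, 1]; junk value 0
   outside of [0, pip p / 2]. *)
Definition sinp0 (R : realType) (p : R) : R -> R :=
  'pinv_(fun=> 0) `[0, 1] (arcsinp p).

(* With x = k pip + r and - pip / 2 <= r < pip / 2, the two symmetries of sin_p
   give sin_p x = (-1)^k sin_p r, and sin_p r = sg r * sin_p |r| by oddness.
   That this is the odd extension of sinp0, symmetric about pip / 2, is proved
   below: arcsinp_sinp, sinp_arcsinp, sinpN, sinp_reflect. *)
Definition sinp (R : realType) (p x : R) : R :=
  let k := Num.floor (x / pip p + 2^-1) in
  let r := x - k%:~R * pip p in
  (-1) ^ k * Num.sg r * sinp0 p `|r|.

Definition cosp (R : realType) (p : R) : R -> R := (sinp p)^`()%classic.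

(* b_j(p) *)
Definition cosp_coeff (R : realType) (p : R) (j : nat) : R :=
  2 * \int[lebesgue_measure]_(x in `[0, 1])
        (cosp p (pip p * x) * cos (j%:R * pi * x)).

Section sinp_theory.
Context {R : realType}.
Notation mu := (@lebesgue_measure R).
Implicit Types p x y t : R.

(* Integrable majorant of the integrand of F_p on [0, 1[. *)
Definition arcsinp_majorant p t : R := (1 - t) `^ (- p^-1).
Definition arcsinp_integrand p t : R := (1 - t `^ p) `^ (- p^-1).

Lemma measurable_majorant p : measurable_fun [set: R] (arcsinp_majorant p).
Proof.
apply: (measurableT_comp (measurable_powR _)).
by apply: measurable_funB => //; exact: measurable_id.
Qed.

Lemma measurable_integrand p : measurable_fun [set: R] (arcsinp_integrand p).
Proof.
apply: (measurableT_comp (measurable_powR _)).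
by apply: measurable_funB => //; exact: measurable_powR.
Qed.

Lemma is_derive_1B t : is_derive t 1 (fun s : R => 1 - s) (-1).
Proof.
have -> : -1 = 0 - 1 :> R by rewrite sub0r.
exact: (@is_deriveB _ _ _ (cst (1:R)) id t 1 0 1 (is_derive_cst _ _ _) (is_derive_id _ _)).
Qed.

Lemma integrable_majorant p : 1 < p -> mu.-integrable `[0, 1] (EFin \o arcsinp_majorant p).
Proof.
move=> p1; have p0 : 0 < p by lra.
have pV : p^-1 < 1 by rewrite invf_lt1.
have pVgt0 : 0 < p^-1 by rewrite invr_gt0.
pose c : R := 1 - p^-1.
have c0 : 0 < c by rewrite /c; lra.
pose G t := - (1 - t) `^ c / c.
have dG t : t < 1 -> is_derive t 1 G (arcsinp_majorant p t).
  move=> t1; rewrite /G /arcsinp_majorant.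
  have h0 : 0 < 1 - t by lra.
  have h1 : is_derive t 1 (fun s : R => 1 - s) (-1).
    exact: is_derive_1B.
  have h2 := is_derive1_powR c h0.
  have h3 := @is_derive1_comp R (fun x : R => x `^ c) (fun s : R => 1 - s) t _ _ h2 h1.
  have -> : (fun t => - (1 - t) `^ c / c) = (- c^-1) \*: ((fun x : R => x `^ c) \o (fun s : R => 1 - s)).
    by apply/funext => s /=; rewrite mulNr mulrC -mulNr.
  have := @is_deriveZ _ _ _ _ (- c^-1) _ _ _ h3.
  move/is_derive_eq; apply; rewrite /GRing.scale/=.
  have -> : c - 1 = - p^-1 by rewrite /c; ring.
  by field; rewrite gt_eqF.
pose b n : R := 1 - n.+2%:R^-1.
have b1 n : b n < 1 by rewrite /b ltrBlDr ltrDl invr_gt0.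
have b0 n : 0 < b n by rewrite /b subr_gt0 invf_lt1// ltr1n.
have ib n : (\int[mu]_(x in `[0%R, b n]) (arcsinp_majorant p x)%:E <= (c^-1)%:E)%E.
  rewrite (@continuous_FTC2 _ (arcsinp_majorant p) G _ _ (b0 n)).
  - rewrite -EFinB lee_fin /G subr0 powR1.
    have := powR_ge0 (1 - b n) c => h.
    rewrite !mulNr mul1r opprK gerDr oppr_le0 mulr_ge0// invr_ge0; exact: ltW.
  - apply: derivable_within_continuous => x /[!in_itv]/= /andP[_ xb].
    have x1 : 0 < 1 - x by have := b1 n; lra.
    apply: ex_derive.
    have h1 : is_derive x 1 (fun s : R => 1 - s) (-1).
      exact: is_derive_1B.
    exact: (@is_derive1_comp R (fun x : R => x `^ (- p^-1)) (fun s : R => 1 - s) x _ _ (is_derive1_powR _ x1) h1).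
  - have cG x : x < 1 -> {for x, continuous G}.
      move=> x1; apply/differentiable_continuous/derivable1_diffP.
      by case: (dG x x1).
    split.
    + move=> x /[!in_itv]/= /andP[_ xb]; apply: ex_derive; apply: dG.
      by rewrite (lt_trans xb).
    + exact: cvg_at_right_filter (cG _ _).
    + exact: cvg_at_left_filter (cG _ _).
  - move=> x /[!in_itv]/= /andP[_ xb]; rewrite derive1E.
    by apply: derive_val; apply: dG; rewrite (lt_trans xb).
have g0 t : (0 <= (arcsinp_majorant p t)%:E)%E by rewrite lee_fin powR_ge0.
have mgE (D : set R) : measurable_fun D (EFin \o arcsinp_majorant p).
  by apply/measurable_EFinP; apply: measurable_funTS; exact: measurable_majorant.
have ndF : nondecreasing_seq (fun n => `[0%R, b n]%classic : set R).
  apply/nondecreasing_seqP => n; rewrite subsetEset.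
  apply: subset_itvl; rewrite bnd_simp /b lerD2l lerN2 lef_pV2 ?posrE//.
  by rewrite ler_nat.
have FE : \bigcup_n `[0%R, b n]%classic = `[0%R, 1%R[%classic :> set R.
  apply/seteqP; split => [x [n _] /=|x /=].
    by rewrite !in_itv/= => /andP[-> xb] /=; rewrite (le_lt_trans xb).
  rewrite in_itv/= => /andP[x0 x1].
  have x10 : 0 < 1 - x by lra.
  exists (Num.bound (1 - x)^-1) => //=; rewrite in_itv/= x0 /= /b.
  rewrite lerBrDl -lerBrDr -[leRHS]invrK lef_pV2 ?posrE ?invr_gt0//.
  have h : 0 <= (1 - x)^-1 by rewrite invr_ge0 ltW.
  rewrite (le_trans (ltW (archi_boundP h)))// ler_nat; lia.
have mF i : measurable (`[0%R, b i]%classic : set R) by [].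
have cv : ((\int[mu]_(x in `[0%R, b n]) (arcsinp_majorant p x)%:E) @[n --> \oo] -->
    \int[mu]_(x in `[0%R, 1%R[) (arcsinp_majorant p x)%:E)%E.
  rewrite -FE; apply: ge0_nondecreasing_set_cvg_integral => // n; exact: mgE.
have le1 : (\int[mu]_(x in `[0%R, 1%R[) (arcsinp_majorant p x)%:E <= (c^-1)%:E)%E.
  rewrite -(cvg_lim _ cv)//; apply: lime_le.
    by apply/cvg_ex; eexists; exact: cv.
  exact: nearW.
apply/integrableP; split; first exact: mgE.
have -> : (\int[mu]_(x in `[0%R, 1%R]) `|(EFin \o arcsinp_majorant p) x| =
    \int[mu]_(x in `[0%R, 1%R]) (EFin \o arcsinp_majorant p) x)%E.
  by apply: eq_integral => x _; rewrite gee0_abs//; exact: g0.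
rewrite -integral_itv_bndo_bndc//.
by rewrite (le_lt_trans le1)// ltry.
Qed.

Lemma integrand_bounds p t : 1 < p -> 0 <= t < 1 -> 1 <= arcsinp_integrand p t <= arcsinp_majorant p t.
Proof.
move=> p1 /andP[t0 t1]; rewrite /arcsinp_integrand /arcsinp_majorant !powRN.
have p0 : 0 < p by lra.
have tp0 := powR_ge0 t p.
have tp : t `^ p <= t.
  have [->|tn0] := eqVneq t 0; first by rewrite powR0// gt_eqF.
  by apply: ge1r_powR; [rewrite lt_neqAle eq_sym tn0 t0 ltW|exact: ltW].
have h : 0 <= p^-1 by rewrite invr_ge0 ltW.
apply/andP; split.
  rewrite -[leLHS]invr1 lef_pV2 ?posrE ?powR_gt0//; last by lra.
  have e1 : 1 `^ p^-1 = 1 :> R by rewrite powR1.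
  by rewrite -[leRHS]e1; apply: ge0_ler_powR; rewrite ?nnegrE//; lra.
rewrite lef_pV2 ?posrE ?powR_gt0//; try lra.
by apply: ge0_ler_powR; rewrite ?nnegrE//; lra.
Qed.

Lemma integrable_integrand p : 1 < p -> mu.-integrable `[0, 1] (EFin \o arcsinp_integrand p).
Proof.
move=> p1; have p0 : 0 < p by lra.
apply: le_integrable (integrable_majorant p1) => //.
  by apply/measurable_EFinP; apply: measurable_funTS; exact: measurable_integrand.
move=> x /= /[!in_itv]/= /andP[x0 x1].
rewrite lee_fin !ger0_norm ?powR_ge0//.
move: x1; rewrite le_eqVlt => /predU1P[->|x1].
  by rewrite /arcsinp_integrand /arcsinp_majorant powR1 subrr.
by have := @integrand_bounds p x p1; rewrite x0 x1 => /(_ isT)/andP[].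
Qed.

Lemma arcsinp0 p : arcsinp p 0 = 0.
Proof. by rewrite /arcsinp set_itv1 Rintegral_set1. Qed.

Lemma arcsinp_lt p : 1 < p -> {in `[0, 1] &, {homo arcsinp p : x y / x < y}}.
Proof.
move=> p1 x y /[!in_itv]/= /andP[x0 x1] /andP[y0 y1] xy.
have fi a b : 0 <= a -> b <= 1 ->
    mu.-integrable `]a, b] (EFin \o arcsinp_integrand p).
  move=> a0 b1; apply: integrableS (integrable_integrand p1) => //.
  by apply: subset_itvScc; rewrite bnd_simp.
have FB a b : 0 <= a -> a <= b -> b <= 1 ->
    arcsinp p b - arcsinp p a = \int[mu]_(t in `]a, b]) arcsinp_integrand p t.
  move=> a0 ab b1; rewrite /arcsinp Rintegral_itvB ?bnd_simp//.
  apply: integrableS (integrable_integrand p1) => //.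
  by apply: subset_itvl; rewrite bnd_simp.
pose m := (x + y) / 2.
have xm : x < m by rewrite /m; lra.
have my : m < y by rewrite /m; lra.
apply: (@lt_le_trans _ _ (arcsinp p m)).
  rewrite -subr_gt0 FB//; [|lra..].
  apply: (@lt_le_trans _ _ (\int[mu]_(t in `]x, m]) (1 : R))).
    by rewrite Rintegral_cst//= lebesgue_measure_itv/= lte_fin xm/= mul1r subr_gt0.
  apply: le_Rintegral => //.
  - have c1 : mu.-integrable `[0, 1] (EFin \o (fun=> 1 : R)).
      apply: continuous_compact_integrable; first exact: segment_compact.
      by move=> ?; exact: cvg_cst.
    apply: integrableS c1 => //.
    by apply: subset_itvScc; rewrite bnd_simp//; lra.
  - by apply: fi => //; lra.
  - move=> t /= /[!in_itv]/= /andP[xt tm].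
    have := @integrand_bounds p t p1; case/(_ _)/andP => //.
    by apply/andP; split; lra.
rewrite -subr_ge0 FB//; [|lra..].
by apply: Rintegral_ge0 => t _; exact: powR_ge0.
Qed.
Lemma arcsinp_inj p : 1 < p -> {in `[0, 1] &, injective (arcsinp p)}.
Proof.
move=> p1 x y x01 y01 xy; case: (ltgtP x y) => // h.
- by have := arcsinp_lt p1 x01 y01 h; rewrite xy ltxx.
- by have := arcsinp_lt p1 y01 x01 h; rewrite xy ltxx.
Qed.

Lemma pip_gt0 p : 1 < p -> 0 < pip p.
Proof.
move=> p1; rewrite /pip mulr_gt0//.
by rewrite -[ltLHS](arcsinp0 p); apply: arcsinp_lt; rewrite // in_itv/= ?lexx ?ler01.
Qed.

Lemma pip_half p : pip p / 2 = arcsinp p 1.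
Proof. by rewrite /pip mulrC mulrA mulVf ?mul1r. Qed.

Lemma arcsinp_cont p : 1 < p -> {within `[0, 1], continuous (arcsinp p)}.
Proof. by move=> p1; exact: parameterized_integral_continuous (integrable_integrand p1). Qed.

Lemma arcsinp_surj p x : 1 < p -> 0 <= x <= pip p / 2 ->
  exists2 y, y \in `[0, 1] & arcsinp p y = x.
Proof.
move=> p1 x0; apply: IVT => //; first exact: arcsinp_cont.
have h := pip_gt0 p1.
rewrite arcsinp0 -pip_half min_l ?max_r//; lra.
Qed.

Lemma arcsinpK p : 1 < p -> {in `[0, 1], cancel (arcsinp p) (sinp0 p)}.
Proof.
move=> p1 y y01; rewrite /sinp0 pinvKV ?inE// => a b.
by rewrite !inE; exact: arcsinp_inj.
Qed.

Lemma sinpE p (k : int) r : 1 < p -> - (pip p / 2) <= r <= pip p / 2 ->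
  sinp p (k%:~R * pip p + r) = (-1) ^ k * Num.sg r * sinp0 p `|r|.
Proof.
move=> p1 /andP[r1 r2]; have P := pip_gt0 p1.
have P0 : pip p != 0 by rewrite gt_eqF.
have E : (k%:~R * pip p + r) / pip p + 2^-1 = k%:~R + (r / pip p + 2^-1).
  by field.
rewrite /sinp E; move: r2; rewrite le_eqVlt => /predU1P[rE|r2].
  have -> : Num.floor (k%:~R + (r / pip p + 2^-1)) = k + 1.
    apply: floor_def; rewrite rE !rmorphD/=.
    have -> : pip p / 2 / pip p = 2^-1 by field.
    by apply/andP; split; lra.
  have -> : k%:~R * pip p + r - (k + 1)%:~R * pip p = - r.
    by rewrite rE rmorphD/=; field.
  by rewrite expfzDr ?oppr_eq0 ?oner_eq0// expr1z normrN sgrN; ring.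
have -> : Num.floor (k%:~R + (r / pip p + 2^-1)) = k.
  apply: floor_def; rewrite rmorphD/= lerDl ltrD2l.
  have : - 2^-1 <= r / pip p < 2^-1.
    by rewrite ler_pdivlMr// ltr_pdivrMr//; apply/andP; split; lra.
  by move=> /andP[? ?]; apply/andP; split; lra.
by rewrite addrC addKr.
Qed.

Lemma pip_decomposition p x : 1 < p -> exists (k : int) r,
  x = k%:~R * pip p + r /\ - (pip p / 2) <= r <= pip p / 2.
Proof.
move=> p1; have P := pip_gt0 p1.
pose k := Num.floor (x / pip p + 2^-1).
exists k, (x - k%:~R * pip p); split; first by ring.
have := floor_itv (x / pip p + 2^-1); rewrite -/k rmorphD/= => /andP[a b].
have ->: x = x / pip p * pip p by rewrite mulfVK// gt_eqF.
by apply/andP; split; nra.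
Qed.

Lemma sinpN p x : 1 < p -> sinp p (- x) = - sinp p x.
Proof.
move=> p1; have [k [r [-> rP]]] := pip_decomposition x p1.
have -> : - (k%:~R * pip p + r) = (- k)%:~R * pip p + - r.
  by rewrite rmorphN/=; ring.
rewrite !sinpE//; last by lra.
by rewrite normrN sgrN -exprz_inv invrN1; ring.
Qed.

Lemma sinp_reflect p x : 1 < p ->
  sinp p (pip p / 2 - x) = sinp p (pip p / 2 + x).
Proof.
move=> p1; have [k [r [E rP]]] := pip_decomposition (pip p / 2 + x) p1.
have -> : pip p / 2 - x = (1 - k)%:~R * pip p + - r.
  have -> : r = pip p / 2 + x - k%:~R * pip p by rewrite E; ring.
  by rewrite rmorphB/=; field.
rewrite E !sinpE//; last by lra.
rewrite normrN sgrN expfzDr ?oppr_eq0 ?oner_eq0// expr1z -exprz_inv invrN1.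
by ring.
Qed.

Lemma sinp_arcsinp p y : 1 < p -> 0 <= y <= 1 -> sinp p (arcsinp p y) = y.
Proof.
move=> p1 y01; have P := pip_gt0 p1.
have yi : y \in `[0, 1] by rewrite in_itv.
have [y00|yn0] := eqVneq y 0.
  have := @sinpE p 0 0 p1; rewrite mul0r add0r sgr0 mulr0 mul0r y00 arcsinp0.
  by apply; lra.
have y0 : 0 < y by rewrite lt_neqAle eq_sym yn0; lra.
have F0 : 0 < arcsinp p y.
  by rewrite -[ltLHS](arcsinp0 p); apply: arcsinp_lt; rewrite // in_itv/= ?lexx ?ler01.
have F1 : arcsinp p y <= pip p / 2.
  rewrite pip_half; have [->//|yn1] := eqVneq y 1.
  by apply/ltW/arcsinp_lt; rewrite // ?in_itv/= ?lexx ?ler01//; lra.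
have := @sinpE p 0 (arcsinp p y) p1; rewrite mul0r add0r expr0z mul1r gtr0_sg// mul1r.
rewrite gtr0_norm// arcsinpK//; apply; lra.
Qed.

Lemma arcsinp_sinp p x : 1 < p -> 0 <= x <= pip p / 2 ->
  0 <= sinp p x <= 1 /\ arcsinp p (sinp p x) = x.
Proof.
move=> p1 xP; have [y yi <-] := arcsinp_surj p1 xP.
by move: yi; rewrite in_itv/= => yi; rewrite sinp_arcsinp.
Qed.
End sinp_theory.

(* Main.v *)
(** Write q = p'. The substitution (1 - t^p)^(1/q) in the integral for pi_q gives
    pi_q = (p - 1) pi_p and cos_p (pi_p (1/2 - u)) = h(u) for 0 < u < 1/2, where
    h(u) = sin_q(pi_q u)^(q - 1) is nondecreasing and concave with h(0) = 0. As
    cos_p is odd about pi_p / 2, b_j = 4 sin(j pi / 2) int_0^(1/2) h(u) sin(j pi u) du;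
    this vanishes for even j. For odd j, cut the integral at the odd multiples
    of 1 / (2 j): by concavity the pieces after the first one alternate in sign,
    decrease, and start with at most twice the first, so the first piece bounds
    the integral. There sin_q x <= x and
    v^(q - 1) <= (q - 1) v + (2 - q) reduce the claim to
    int_0^1 ((q - 1) v + (2 - q)) sin(pi v / 2) dv
      = 4 (q - 1) / pi^2 + 2 (2 - q) / pi < 4 (q - 1) / pi^2 + (2 - q). *)
Require Import Defs.
From HB Require Import structures.
From mathcomp Require Import all_boot all_order all_algebra.
From mathcomp Require Import all_classical all_reals all_analysis.
From mathcomp Require Import measurable_realfun ring lra.
Import Order.TTheory GRing.Theory Num.Theory.
Import numFieldNormedType.Exports.
Local Open Scope classical_set_scope.
Local Open Scope ring_scope.

(** * Integrals of continuous functions: cutting, affine changes of variable, clamping *)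

Section continuous_Rintegral.
Set Implicit Arguments.
Unset Strict Implicit.
Context {R : realType}.
Notation mu := (@lebesgue_measure R).
Implicit Types (f g : R -> R) (a b c k : R).

Lemma continuousR_comp f g : continuous f -> continuous g ->
  continuous (fun x => g (f x)).
Proof. by move=> cf cg x; apply: (@cvg_comp _ _ _ f g); [exact: cf|exact: cg]. Qed.

Lemma continuous_affine k c : continuous (fun x : R => k * x + c).
Proof.
by move=> x; apply: cvgD; [apply: cvgMr; exact: cvg_id|exact: cvg_cst].
Qed.

Lemma continuous_integrable f a b : continuous f ->
  mu.-integrable `[a, b] (EFin \o f).
Proof.
move=> cf; apply: continuous_compact_integrable; first exact: segment_compact.
exact: continuous_subspaceT.
Qed.

Lemma continuous_Rintegral_cat f a b c : continuous f -> a <= b -> b <= c ->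
  \int[mu]_(x in `[a, c]) f x =
  \int[mu]_(x in `[a, b]) f x + \int[mu]_(x in `[b, c]) f x.
Proof.
move=> cf ab bc.
have ic : mu.-integrable `]b, c] (EFin \o f).
  apply: integrableS (continuous_integrable b c cf) => //.
  exact: subset_itv_oc_cc.
apply/eqP; rewrite addrC -subr_eq Rintegral_itvB ?bnd_simp//.
  by rewrite Rintegral_itv_obnd_cbnd.
exact: continuous_integrable.
Qed.

Lemma continuous_Rintegral_affine f a b c k : continuous f -> 0 < k -> a <= b ->
  \int[mu]_(x in `[k * a + c, k * b + c]) f x =
  k * \int[mu]_(x in `[a, b]) f (k * x + c).
Proof.
move=> cf k0 ab.
pose F x := k * x + c.
have dF (x : R) : is_derive x 1 F k.
  by apply: is_derive_eq; rewrite /GRing.scale/= mulr1 addr0.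
have cF : continuous F by exact: continuous_affine.
have F'E : F^`()%classic = cst k.
  by apply/funext => x; rewrite derive1E derive_val.
have cfF : continuous (fun x => f (k * x + c)) by exact: continuousR_comp.
rewrite -RintegralZl//; last exact: continuous_integrable.
rewrite /Rintegral; congr fine.
rewrite (@integration_by_substitution_increasing _ F f a b ab).
- by apply: eq_integral => x _; rewrite F'E/= mulrC.
- by move=> x y _ _ xy; rewrite /F ltrD2r ltr_pM2l.
- by rewrite F'E => x _; exact: cvg_cst.
- by rewrite F'E; exact: is_cvg_cst.
- by rewrite F'E; exact: is_cvg_cst.
- split; first by move=> x _; case: (dF x).
  + exact: cvg_at_right_filter (cF _).
  + exact: cvg_at_left_filter (cF _).
- exact: continuous_subspaceT.
Qed.

Lemma continuous_Rintegral_reflect f a b c k : continuous f -> 0 < k -> a <= b ->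
  \int[mu]_(x in `[c - k * b, c - k * a]) f x =
  k * \int[mu]_(x in `[a, b]) f (c - k * x).
Proof.
move=> cf k0 ab.
have -> : `[c - k * b, c - k * a] = `[k * - b + c, k * - a + c].
  by congr `[_, _]; ring.
rewrite continuous_Rintegral_affine ?lerN2//; congr (_ * _).
rewrite /Rintegral integration_by_substitution_oppr//; last first.
  apply/continuous_subspaceT/(continuousR_comp _ cf)/continuous_affine.
by congr fine; apply: eq_integral => x _ /=; rewrite mulrN addrC.
Qed.

(** Composing with [clamp a b] turns a function continuous on [[a, b]] into one continuous on all of
    [R], to which the integral lemmas above apply. *)
Definition clamp a b x : R := Num.max a (Num.min x b).

Lemma clamp_itv a b x : a <= b -> a <= clamp a b x <= b.
Proof. by move=> ab; rewrite /clamp le_max lexx ge_max ab ge_min lexx orbT. Qed.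

Lemma clamp_id a b x : a <= x <= b -> clamp a b x = x.
Proof. by move=> /andP[ax xb]; rewrite /clamp min_l// max_r. Qed.

Lemma clampr a b x : a <= b -> b <= x -> clamp a b x = b.
Proof. by move=> ab bx; rewrite /clamp min_r// max_r. Qed.

Lemma clampl a b x : x <= a -> clamp a b x = a.
Proof. by move=> xa; rewrite /clamp max_l// ge_min xa. Qed.

Lemma le_clamp a b : {homo clamp a b : x y / x <= y}.
Proof.
move=> x y xy; rewrite /clamp ge_max !le_max lexx/= le_min !ge_min xy lexx.
by rewrite !orbT.
Qed.

Lemma continuous_clamp a b : continuous (clamp a b).
Proof.
have -> : clamp a b = fun x =>
    (a + (x + b - `|x - b|) / 2 + `|a - (x + b - `|x - b|) / 2|) / 2.
  by apply/funext => x; rewrite /clamp maxr_absE minr_absE.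
have cm x : (y + b - `|y - b|) / 2 @[y --> x] --> (x + b - `|x - b|) / 2.
  apply: cvgMl; apply: cvgB; first by apply: cvgD; [exact: cvg_id|exact: cvg_cst].
  by apply: cvg_norm; apply: cvgB; [exact: cvg_id|exact: cvg_cst].
move=> x; apply: cvgMl; apply: cvgD.
  by apply: cvgD; [exact: cvg_cst|exact: cm].
by apply: cvg_norm; apply: cvgB; [exact: cvg_cst|exact: cm].
Qed.

Lemma continuous_comp_clamp f a b : a <= b -> {within `[a, b], continuous f} ->
  continuous (f \o clamp a b).
Proof.
move=> ab /subspace_continuousP cf x.
have xab : `[a, b]%classic (clamp a b x) by rewrite /= in_itv/= clamp_itv.
apply: cvg_comp (cf _ xab) => A /= wA.
have := @continuous_clamp a b x _ wA; rewrite nbhs_nearE /= => nA.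
near=> y; have /(_ _) : `[a, b]%classic (clamp a b y) -> A (clamp a b y).
  by near: y.
by apply; rewrite /= in_itv/= clamp_itv.
Unshelve. all: by end_near. Qed.

(* Without the absolute value continuity fails at 0: x `^ r = 1 for x < 0. *)
Lemma continuous_powR_norm r : 0 < r -> continuous (fun x : R => `|x| `^ r).
Proof.
move=> r0 x; have [->|x0] := eqVneq x 0; last first.
  have nx : 0 < `|x| by rewrite normr_gt0.
  apply: (@cvg_comp _ _ _ Num.norm (@powR R ^~ r)).
    exact: (@norm_continuous _ R).
  have : {for `|x|, continuous (@powR R ^~ r)}.
    apply/differentiable_continuous/derivable1_diffP.
    by case: (is_derive1_powR r nx).
  exact.
apply/cvgrPdist_lt => e e0; rewrite normr0 powR0 ?gt_eqF//.
near=> y; rewrite sub0r normrN ger0_norm ?powR_ge0//.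
have -> : e = (e `^ r^-1) `^ r by rewrite -powRrM mulVf ?gt_eqF// powRr1// ltW.
apply: gt0_ltr_powR => //; rewrite ?nnegrE ?powR_ge0//.
near: y; exists (e `^ r^-1); first exact: powR_gt0.
by move=> y /=; rewrite sub0r normrN.
Unshelve. all: by end_near. Qed.

End continuous_Rintegral.

(** * Integrals of a concave function against a sine *)

Section sine_integral.
Set Implicit Arguments.
Unset Strict Implicit.
Context {R : realType}.
Notation mu := (@lebesgue_measure R).
Variable f : R -> R.
Hypothesis cf : continuous f.

Let sn (x : R) : R := sin (pi / 2 * x).

Let continuous_sn : continuous sn.
Proof.
have -> : sn = fun x => sin (pi / 2 * x + 0) by apply/funext => x; rewrite addr0.
exact: (continuousR_comp (@continuous_affine R (pi / 2) 0) (@continuous_sin R)).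
Qed.

Let sn_shift (k : nat) x : sn (k%:R * 2 + x) = (-1) ^+ k * sn x.
Proof.
rewrite /sn -(alternatingn (@sinDpi R) k); congr sin.
by rewrite -mulr_natr; field.
Qed.

Let sn_ge0 x : 0 <= x <= 1 -> 0 <= sn x.
Proof.
move=> /andP[x0 x1]; have := pi_gt0 R => pi0.
by apply: sin_ge0_pi; apply/andP; split; nra.
Qed.

Let D (k : nat) (v : R) : R := f (k%:R * 2 + v) - f (k%:R * 2 - v).

Let continuous_D k : continuous (D k).
Proof.
have -> : D k = fun v => f (1 * v + k%:R * 2) - f (-1 * v + k%:R * 2).
  by apply/funext => v; rewrite /D mul1r mulN1r ![_ + k%:R * 2]addrC.
have h c := continuousR_comp (@continuous_affine R c (k%:R * 2)) cf.
by move=> v; apply: cvgB; exact: h.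
Qed.

Let continuousM_sn (g : R -> R) : continuous g -> continuous (fun x => g x * sn x).
Proof. by move=> cg x; apply: cvgM; [exact: cg|exact: continuous_sn]. Qed.

Let J (k : nat) : R := \int[mu]_(v in `[0, 1]) (D k v * sn v).

(** Up to the sign [(-1) ^+ k], the sine is odd about [2 k]. Folding the left half of the segment
    onto the right half therefore leaves the difference [D k] of the values of [f]. *)
Let half_period (k : nat) :
  \int[mu]_(x in `[k%:R * 2 - 1, k%:R * 2 + 1]) (f x * sn x) = (-1) ^+ k * J k.
Proof.
set N := k%:R * 2.
have cfs := continuousM_sn cf.
rewrite (@continuous_Rintegral_cat _ _ _ N)//; [|lra..].
have -> : `[N - 1, N] = `[N - 1 * 1, N - 1 * 0] by congr `[_, _]; ring.
have -> : `[N, N + 1] = `[1 * 0 + N, 1 * 1 + N] by congr `[_, _]; ring.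
rewrite continuous_Rintegral_reflect// continuous_Rintegral_affine//.
rewrite !mul1r addrC -RintegralD//; last 2 first.
- exact/continuous_integrable/(continuousR_comp (@continuous_affine R 1 N) cfs).
- have -> : (fun x => f (N - 1 * x) * sn (N - 1 * x)) =
      fun x => f (-1 * x + N) * sn (-1 * x + N).
    by apply/funext => x; rewrite mul1r mulN1r addrC.
  exact/continuous_integrable/(continuousR_comp (@continuous_affine R (-1) N) cfs).
rewrite -RintegralZl//; last exact/continuous_integrable/continuousM_sn/continuous_D.
apply: eq_Rintegral => x _; rewrite !mul1r (addrC _ N).
rewrite !sn_shift /D -/N.
have -> : sn (- x) = - sn x by rewrite /sn mulrN sinN.
ring.
Qed.

Hypothesis f0 : f 0 = 0.
Hypothesis f_nondecreasing : forall a b, 0 <= a -> a <= b -> f a <= f b.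
Hypothesis f_increments : forall a b l, 0 <= a -> a <= b -> 0 <= l ->
  f (b + l) - f b <= f (a + l) - f a.

Let J_ge0 k : (0 < k)%N -> 0 <= J k.
Proof.
move=> k0; apply: Rintegral_ge0 => x /=; rewrite in_itv/= => x01.
rewrite mulr_ge0 ?sn_ge0// /D subr_ge0.
have k1 : 1 <= k%:R :> R by rewrite ler1n.
by apply: f_nondecreasing; lra.
Qed.

(** [D k v] is the increment of [f] over length [2 v] from [2 k - v], which is nonnegative as [k] is
    positive; moving the starting point right by 2 can only shrink it. *)
Let J_nonincreasing k : (0 < k)%N -> J k.+1 <= J k.
Proof.
move=> k0; apply: le_Rintegral => //.
- exact/continuous_integrable/continuousM_sn/continuous_D.
- exact/continuous_integrable/continuousM_sn/continuous_D.
move=> x /=; rewrite in_itv/= => x01.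
rewrite ler_wpM2r ?sn_ge0// /D.
have k1 : 1 <= k%:R :> R by rewrite ler1n.
have := @f_increments (k%:R * 2 - x) (k.+1%:R * 2 - x) (x + x).
have -> : k%:R * 2 - x + (x + x) = k%:R * 2 + x by ring.
have -> : k.+1%:R * 2 - x + (x + x) = k.+1%:R * 2 + x by ring.
by apply; rewrite -?(natr1 _ k); lra.
Qed.

(** Concavity used twice: [f (2 + v) - f (2 - v) <= f (2 v) <= 2 f v], as [f 0 = 0]. *)
Let J1_le : J 1 <= 2 * \int[mu]_(v in `[0, 1]) (f v * sn v).
Proof.
rewrite -RintegralZl//; last exact/continuous_integrable/continuousM_sn.
apply: le_Rintegral => //.
- exact/continuous_integrable/continuousM_sn/continuous_D.
- apply: continuous_integrable => x; apply: cvgMr.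
  exact: continuousM_sn.
move=> x /=; rewrite in_itv/= => x01.
rewrite mulrA ler_wpM2r ?sn_ge0// /D.
have h1 := @f_increments 0 (1 * 2 - x) (x + x).
have h2 := @f_increments 0 x x.
move: h1 h2; rewrite f0 !add0r !subr0.
have -> : 1 * 2 - x + (x + x) = 1 * 2 + x by ring.
by move=> /(_ _ _ _)-h1 /(_ _ _ _)-h2; have := h1; have := h2; lra.
Qed.

(* Over the half-periods of the sine centred at the even integers, the integral
   is an alternating sum of decreasing terms, the first of which is at most
   twice the integral over [0, 1]. *)
Lemma sine_integral_le (m : nat) :
  `|\int[mu]_(x in `[0, m%:R * 2 + 1]) (f x * sin (pi / 2 * x))| <=
  \int[mu]_(x in `[0, 1]) (f x * sin (pi / 2 * x)).
Proof.
pose A (m : nat) := \int[mu]_(x in `[0, m%:R * 2 + 1]) (f x * sn x).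
have A0 : A 0%N = \int[mu]_(x in `[0, 1]) (f x * sn x).
  by rewrite /A mul0r add0r.
have AS k : A k.+1 = A k + (-1) ^+ k.+1 * J k.+1.
  have kE : k.+1%:R * 2 - 1 = k%:R * 2 + 1 :> R by rewrite -natr1; ring.
  have k0 : 0 <= k%:R :> R by [].
  rewrite -half_period kE -continuous_Rintegral_cat//; [|lra..].
  exact: continuousM_sn.
rewrite -/(A m) -/(sn _) -A0.
have J1 := J1_le; rewrite -A0 in J1.
(* The invariant keeps a slack of [J k.+1] on the side towards which the next term moves. In the end
   [A m] lies between [A 0 - J 1] and [A 0], and [J 1 <= 2 A 0] bounds its absolute value. *)
have bounds k : if odd k then A 0%N - J 1 <= A k <= A 0%N - J k.+1
                else A 0%N - J 1 + J k.+1 <= A k <= A 0%N.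
  elim: k => [|k] /=; first by lra.
  have := @J_nonincreasing k.+1 isT; have := @J_ge0 k.+2 isT.
  rewrite AS -signr_odd /=; case: (odd k) => /=; rewrite ?expr0 ?expr1; lra.
have := bounds m; have := @J_ge0 m.+1 isT; rewrite ler_norml.
by case: (odd m); lra.
Qed.

End sine_integral.

(** * Derivative, monotonicity and continuity of sin_p, and the bound sin_p x <= x *)

Section sinp_derivative.
Set Implicit Arguments.
Unset Strict Implicit.
Context {R : realType}.
Notation mu := (@lebesgue_measure R).
Implicit Types p x y : R.

Lemma powR_lt1 y r : 0 < r -> 0 <= y < 1 -> y `^ r < 1.
Proof.
move=> r0 /andP[y0 y1]; have -> : 1 = 1 `^ r :> R by rewrite powR1.
by apply: gt0_ltr_powR; rewrite ?nnegrE.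
Qed.

Lemma powR_le1 y r : 0 <= r -> 0 <= y <= 1 -> y `^ r <= 1.
Proof.
move=> r0 /andP[y0 y1]; have -> : 1 = 1 `^ r :> R by rewrite powR1.
by apply: ge0_ler_powR; rewrite ?nnegrE.
Qed.

Lemma is_derive_1B_powR p r y : 0 < y -> y `^ p < 1 ->
  is_derive y 1 (fun t => (1 - t `^ p) `^ r)
    (r * (1 - y `^ p) `^ (r - 1) * - (p * y `^ (p - 1))).
Proof.
move=> y0 yp1; have h : 0 < 1 - y `^ p by lra.
have d1 := is_derive1_powR p y0.
have d2 : is_derive y 1 (fun t => 1 - t `^ p) (- (p * y `^ (p - 1))).
  rewrite -[- (p * _)]mulN1r.
  exact: (@is_derive1_comp _ (fun s => 1 - s) (@powR R ^~ p) _ _ _ (is_derive_1B _) d1).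
exact: (@is_derive1_comp R (@powR R ^~ r) (fun t => 1 - t `^ p) _ _ _ (is_derive1_powR r h) d2).
Qed.

Lemma is_derive_arcsinp p y : 1 < p -> 0 < y < 1 ->
  is_derive y 1 (arcsinp p) ((1 - y `^ p) `^ (- p^-1)).
Proof.
move=> p1 /andP[y0 y1]; have p0 : 0 < p by lra.
have yp1 : y `^ p < 1 by rewrite powR_lt1// ltW.
have ci : {for y, continuous (arcsinp_integrand p)}.
  apply/differentiable_continuous/derivable1_diffP.
  by case: (is_derive_1B_powR (- p^-1) y0 yp1).
have [d1 d2] := continuous_FTC1_closed y1 (integrable_integrand p1) y0 ci.
by split; [exact: d1|rewrite -derive1E; exact: d2].
Qed.

Lemma is_derive_sinp_arcsinp p y : 1 < p -> 0 < y < 1 ->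
  is_derive (arcsinp p y) 1 (sinp p) ((1 - y `^ p) `^ p^-1).
Proof.
move=> p1 y01; have y01i : y \in `]0, 1[ by rewrite in_itv.
have -> : (1 - y `^ p) `^ p^-1 = ((1 - y `^ p) `^ (- p^-1))^-1.
  by rewrite powRN invrK.
apply: is_derive_inverse.
- near=> z; rewrite sinp_arcsinp//.
  have : z \in `]0, 1[ by near: z; exact: near_in_itvoo.
  by rewrite in_itv/= => /andP[z0 z1]; rewrite !ltW.
- near=> z; apply/differentiable_continuous/derivable1_diffP.
  have z01 : 0 < z < 1.
    have : z \in `]0, 1[ by near: z; exact: near_in_itvoo.
    by rewrite in_itv.
  by case: (is_derive_arcsinp p1 z01).
- exact: is_derive_arcsinp.
- rewrite gt_eqF// powR_gt0// subr_gt0 powR_lt1//; lra.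
Unshelve. all: by end_near. Qed.

Lemma sinp_itvoo p x : 1 < p -> 0 < x < pip p / 2 ->
  0 < sinp p x < 1 /\ arcsinp p (sinp p x) = x.
Proof.
move=> p1 /andP[x0 x1].
have [|/andP[s0 s1] sK] := arcsinp_sinp (x := x) p1; first lra.
split=> //; rewrite !lt_neqAle s0 s1 !andbT; apply/andP; split.
  by apply/eqP => s0'; move: x0; rewrite -sK -s0' arcsinp0 ltxx.
by apply/eqP => s1'; move: x1; rewrite -sK s1' pip_half ltxx.
Qed.

Lemma is_derive_sinp p x : 1 < p -> 0 < x < pip p / 2 ->
  is_derive x 1 (sinp p) ((1 - sinp p x `^ p) `^ p^-1).
Proof.
by move=> p1 /(sinp_itvoo p1)[s01 xE]; rewrite -[x in is_derive x]xE;
  exact: is_derive_sinp_arcsinp.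
Qed.

Lemma sinp_le p x y : 1 < p -> 0 <= x -> x <= y -> y <= pip p / 2 ->
  sinp p x <= sinp p y.
Proof.
move=> p1 x0 xy y1.
have [|sx xE] := arcsinp_sinp (x := x) p1; first lra.
have [|sy yE] := arcsinp_sinp (x := y) p1; first lra.
rewrite leNgt; apply/negP => /(arcsinp_lt p1).
by rewrite !in_itv/= sx sy xE yE ltNge xy => /(_ isT isT).
Qed.

Lemma sinp_continuous p : 1 < p -> {within `[0, pip p / 2], continuous (sinp p)}.
Proof.
move=> p1; rewrite pip_half -(arcsinp0 p).
apply: (segment_can_le_continuous ler01 (arcsinp_cont p1)) => y.
by rewrite in_itv/=; exact: sinp_arcsinp.
Qed.

Lemma arcsinp_ge p y : 1 < p -> 0 <= y <= 1 -> y <= arcsinp p y.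
Proof.
move=> p1 /andP[y0 y1].
(* The half-open segment leaves out [t = 1], where the integrand takes the default value 0 and the
   lower bound 1 fails. *)
have yE : y = \int[mu]_(t in `[0, y[) (1 : R).
  rewrite Rintegral_cst//= lebesgue_measure_itv/= lte_fin mul1r.
  have := y0; rewrite le_eqVlt => /predU1P[<-|y0']; first by rewrite ltxx.
  by rewrite y0'/= subr0.
have ii : mu.-integrable `[0, y[ (EFin \o arcsinp_integrand p).
  apply: integrableS (integrable_integrand p1) => //.
  by apply: subset_itvl; rewrite bnd_simp.
rewrite [leLHS]yE /arcsinp -Rintegral_itv_bndo_bndc//.
apply: le_Rintegral => //.
  have c1 : continuous (fun _ : R => 1 : R) by move=> x; exact: cvg_cst.
  apply: integrableS (@continuous_integrable _ _ 0 y c1) => //.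
  exact: subset_itv_co_cc.
move=> t /=; rewrite in_itv/= => /andP[t0 ty].
have := @integrand_bounds _ p t p1.
by rewrite t0 (lt_le_trans ty y1) => /(_ isT)/andP[].
Qed.

Lemma sinp_ge0_le p x : 1 < p -> 0 <= x <= pip p / 2 -> 0 <= sinp p x <= x.
Proof.
move=> p1 x01; have [s01 xE] := arcsinp_sinp p1 x01.
by have := arcsinp_ge p1 s01; rewrite xE; lra.
Qed.

Lemma pip_ge2 p : 1 < p -> 2 <= pip p.
Proof.
move=> p1; have := @arcsinp_ge p 1 p1; rewrite -pip_half lexx ler01 => /(_ isT).
lra.
Qed.

End sinp_derivative.

(** * Duality between the exponents p and q = p / (p - 1) *)

Section duality.
Set Implicit Arguments.
Unset Strict Implicit.
Context {R : realType}.
Implicit Types p q x y : R.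

(* The difference of the two sides has derivative 0 on ]0, 1[ and vanishes at 1. *)
Lemma arcsinp_dual p q y : 1 < p -> q = p / (p - 1) -> 0 <= y <= 1 ->
  arcsinp q ((1 - y `^ p) `^ q^-1) = (p - 1) * (pip p / 2 - arcsinp p y).
Proof.
move=> p1 qE /andP[y0 y1]; have p0 : 0 < p by lra.
have q1 : 1 < q by rewrite qE ltr_pdivlMr; lra.
have pB0 : p - 1 != 0 by rewrite gt_eqF//; lra.
have pn0 : p != 0 by rewrite gt_eqF.
have qV0 : 0 < q^-1 by rewrite invr_gt0; lra.
pose w t : R := (1 - t `^ p) `^ q^-1.
pose G t := arcsinp q (w t) + (p - 1) * arcsinp p t.
have dG t : t \in `]y, 1[ -> is_derive t 1 G ((fun=> 0) t).
  rewrite in_itv/= => /andP[yt t1]; have t0 : 0 < t by exact: le_lt_trans yt.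
  have tp1 : t `^ p < 1 by rewrite powR_lt1// ltW.
  have u0 : 0 < 1 - t `^ p by rewrite subr_gt0.
  have tp0 : 0 < t `^ p by exact: powR_gt0.
  have w01 : 0 < w t < 1.
    by rewrite powR_gt0// powR_lt1// ltW//=; lra.
  have d1 := @is_derive1_comp R (arcsinp q) w _ _ _
    (is_derive_arcsinp q1 w01) (is_derive_1B_powR q^-1 t0 tp1).
  have d2 := @is_deriveZ _ _ _ _ (p - 1) _ _ _
    (@is_derive_arcsinp R p t p1 (introT andP (conj t0 t1))).
  apply: (is_derive_eq (is_deriveD d1 d2)).
  (* Since [w t ^ q = 1 - t ^ p], the outer derivative is [(t ^ p) ^ (- 1 / q) = t ^ (- (p - 1))].
     It cancels the [t ^ (p - 1)] of the inner one, and with [p / q = p - 1] the two summands are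
     opposite. *)
  rewrite /GRing.scale/= /w -powRrM mulVf ?gt_eqF//; last lra.
  rewrite powRr1 ?(ltW u0)// subKr -powRrM.
  have -> : p * - q^-1 = - (p - 1) by rewrite qE; field; rewrite pB0 pn0.
  have -> : q^-1 - 1 = - p^-1 by rewrite qE; field; rewrite pB0 pn0.
  have -> : q^-1 = (p - 1) / p by rewrite qE invf_div.
  rewrite (powRN t); field.
  by rewrite pn0 gt_eqF// powR_gt0.
have cG : {within `[0, 1], continuous G}.
  (* [G'] agrees with [G] on [[0, 1]] and is continuous on [R]: norms keep the bases of the powers
     nonnegative, clamps keep the arguments of [arcsinp] in [[0, 1]]. *)
  pose G' t := arcsinp q (clamp 0 1 (`|1 - `|t| `^ p| `^ q^-1)) +
               (p - 1) * arcsinp p (clamp 0 1 t).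
  have cw : continuous (fun t : R => `|1 - `|t| `^ p| `^ q^-1).
    have c1 : continuous (fun t : R => 1 - `|t| `^ p).
      by move=> t; apply: cvgB; [exact: cvg_cst|exact: continuous_powR_norm].
    exact: (continuousR_comp c1 (continuous_powR_norm qV0)).
  have cG' : continuous G'.
    move=> t; apply: cvgD.
      exact: (continuousR_comp cw (continuous_comp_clamp ler01 (arcsinp_cont q1))).
    apply: cvgMr.
    exact: (continuous_comp_clamp ler01 (arcsinp_cont p1)).
  apply: (@subspace_eq_continuous _ _ _ G'); last exact: continuous_subspaceT.
  move=> t; rewrite inE/= in_itv/= => /andP[t0 t1]; rewrite /G' /G /w.
  have u0 : 0 <= 1 - t `^ p.
    by rewrite subr_ge0 powR_le1 ?t0 ?(ltW p0).
  rewrite (ger0_norm t0) (ger0_norm u0) !clamp_id ?t0 ?powR_ge0//=.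
  by rewrite powR_le1 ?(ltW qV0)// u0 gerBl powR_ge0.
have cGy : {within `[y, 1], continuous G}.
  by apply: continuous_subspaceW cG; apply: subset_itvr; rewrite bnd_simp.
have [c _] := MVT_segment y1 dG cGy.
rewrite mul0r /G /w powR1 subrr powR0 ?gt_eqF// arcsinp0 add0r -pip_half.
by move/eqP; rewrite subr_eq0 mulrBr => /eqP ->; rewrite addrK.
Qed.

Lemma pip_dual p q : 1 < p -> q = p / (p - 1) -> pip q = (p - 1) * pip p.
Proof.
move=> p1 qE; have := @arcsinp_dual p q 0 p1 qE.
rewrite lexx ler01 arcsinp0 powR0 ?gt_eqF; [|lra..].
rewrite !subr0 powR1 -(pip_half q) => /(_ isT) h.
by rewrite -[LHS](divfK (_ : 2 != 0))// h -mulrA divfK.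
Qed.

(** With [y = sinp p x], the derivative of sin_p is [(1 - y ^ p) ^ (1 / p)]. As
    [(q - 1) / q = 1 / p], this is the power [q - 1] of [(1 - y ^ p) ^ (1 / q)], which
    [arcsinp_dual] identifies as a value of sin_q. *)
Lemma cosp_dual p q x : 1 < p -> q = p / (p - 1) -> 0 < x < pip p / 2 ->
  cosp p x = sinp q ((p - 1) * (pip p / 2 - x)) `^ (q - 1).
Proof.
move=> p1 qE x01; have q1 : 1 < q by rewrite qE ltr_pdivlMr; lra.
have [s01 xE] := sinp_itvoo p1 x01.
have sp1 : sinp p x `^ p < 1 by rewrite powR_lt1//; lra.
have sp0 := powR_ge0 (sinp p x) p.
rewrite -[in RHS]xE -(arcsinp_dual p1 qE); last lra.
rewrite sinp_arcsinp// ?powR_ge0/=; last first.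
  rewrite powR_le1 ?invr_ge0; lra.
have d := is_derive_sinp p1 x01.
rewrite /cosp derive1E (@derive_val _ _ _ _ _ _ _ d) -powRrM; congr (_ `^ _).
by rewrite qE; field; rewrite !gt_eqF//; lra.
Qed.

(** Obtained by differentiating [sinp p t = sinp p (pip p - t)]. *)
Lemma cosp_reflect p x : 1 < p -> 0 < x < pip p / 2 ->
  cosp p (pip p - x) = - cosp p x.
Proof.
move=> p1 x01.
have d1 := is_derive_sinp p1 x01.
have E : sinp p = (sinp p) \o (fun t => pip p - t).
  apply/funext => t /=.
  have := sinp_reflect (pip p / 2 - t) p1.
  have -> : pip p / 2 - (pip p / 2 - t) = t by ring.
  by have -> : pip p / 2 + (pip p / 2 - t) = pip p - t by field.
have d2 : is_derive (pip p - x) 1 (fun t => pip p - t) (-1).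
  rewrite -[-1]sub0r.
  exact: (@is_deriveB _ _ _ (cst (pip p)) id _ 1 0 1 (is_derive_cst _ _ _) (is_derive_id _ _)).
rewrite -[x in is_derive x _ _ _](subKr (pip p)) in d1.
have d3 := @is_derive1_comp _ _ (fun t => pip p - t) _ _ _ d1 d2.
rewrite -E in d3.
rewrite /cosp !derive1E (@derive_val _ _ _ _ _ _ _ d3).
by rewrite (@derive_val _ _ _ _ _ _ _ (is_derive_sinp p1 x01)) mulrN1.
Qed.

End duality.

(** * Increments of a function that is concave and then constant *)

Section concave_increments.
Set Implicit Arguments.
Unset Strict Implicit.
Context {R : realType}.
Implicit Types (f df : R -> R).

(** Up to [c], the mean value theorem applies to [x |-> f (x + l) - f x], whose derivative is
    nonpositive. Past [c] the function is constant, and monotonicity settles the rest. *)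
Lemma concave_increments f df (c : R) : continuous f ->
  (forall x, c <= x -> f x = f c) ->
  (forall x, 0 < x < c -> is_derive x 1 f (df x)) ->
  (forall x y, 0 < x -> x <= y -> y < c -> df y <= df x) ->
  (forall x y, 0 <= x -> x <= y -> f x <= f y) ->
  forall a b l, 0 <= a -> a <= b -> 0 <= l ->
  f (b + l) - f b <= f (a + l) - f a.
Proof.
move=> cf fc dE dn fn.
have inner a b l : 0 <= a -> a <= b -> 0 <= l -> b + l <= c ->
    f (b + l) - f b <= f (a + l) - f a.
  move=> a0; rewrite le_eqVlt => /predU1P[->//|ab] l0 blc.
  pose phi x := f (x + l) - f x.
  have dphi x : x \in `]a, b[ -> is_derive x 1 phi (df (x + l) - df x).
    rewrite in_itv/= => /andP[ax xb].
    have d1 : is_derive (x + l) 1 f (df (x + l)) by apply: dE; lra.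
    have d2 : is_derive x 1 f (df x) by apply: dE; lra.
    have d4 := @is_derive1_comp _ _ (shift l) _ _ _ d1 (is_derive_shift x 1 l).
    by rewrite mulr1 in d4; exact: (is_deriveB d4 d2).
  have cphi : continuous phi.
    have cfl : continuous (fun x => f (x + l)).
      have -> : (fun x => f (x + l)) = (fun x => f (1 * x + l)).
        by apply/funext => x; rewrite mul1r.
      exact: (continuousR_comp (@continuous_affine R 1 l) cf).
    by move=> x; apply: cvgB; [exact: cfl|exact: cf].
  have [z zab phiE] := MVT ab dphi (continuous_subspaceT cphi).
  move: zab; rewrite in_itv/= => /andP[az zb].
  rewrite -subr_le0 -/(phi b) -/(phi a) phiE.
  have h : df (z + l) <= df z by apply: dn; lra.
  by nra.
move=> a b l a0 ab l0.
have [blc|cbl] := leP (b + l) c; first exact: inner.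
rewrite (fc _ (ltW cbl)).
have [cal|alc] := leP c (a + l).
  by rewrite (fc _ cal) lerD2l lerN2 fn.
(* Only the right interval passes [c]: it is slid back to end at [c], which does not decrease its
   increment. *)
have h := @inner a (c - l) l a0; rewrite subrK in h.
have h1 : f c - f (c - l) <= f (a + l) - f a by apply: h; lra.
have h2 : f (c - l) <= f b by apply: fn; lra.
lra.
Qed.

End concave_increments.

(** * The concave function sin_q ^ (q - 1) *)

Section sinp_power.
Set Implicit Arguments.
Unset Strict Implicit.
Context {R : realType}.
Variable q : R.
Hypotheses (q1 : 1 < q) (q2 : q < 2).

(* On [0, pip q / 2] this is sin_q(x)^(q - 1); the clamp extends it by constants
   to a function that is continuous on R and concave on [0, +oo[, and that
   vanishes for x <= 0. *)
Definition sinp_power (q x : R) : R := `|sinp q (clamp 0 (pip q / 2) x)| `^ (q - 1).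

Let P : R := pip q / 2.
Let P_gt0 : 0 < P. Proof. by rewrite divr_gt0// pip_gt0. Qed.
Let qB1 : 0 < q - 1. Proof. by rewrite subr_gt0. Qed.
Let s (x : R) : R := sinp q (clamp 0 P x).
Let s_ge0_le x : 0 <= x -> 0 <= s x <= x.
Proof.
move=> x0; have := @sinp_ge0_le _ q (clamp 0 P x) q1 (clamp_itv x (ltW P_gt0)).
move=> /andP[-> h]/=; apply: (le_trans h).
by rewrite /clamp ge_max x0 ge_min lexx.
Qed.

Let s_le x y : x <= y -> s x <= s y.
Proof.
move=> xy; have /andP[x0 xP] := clamp_itv x (ltW P_gt0).
have /andP[y0 yP] := clamp_itv y (ltW P_gt0).
by apply: sinp_le => //; exact: le_clamp.
Qed.

Let s_ge0 x : 0 <= s x.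
Proof.
by have /andP[] := sinp_ge0_le q1 (clamp_itv x (ltW P_gt0)).
Qed.

Lemma sinp_power_continuous : continuous (sinp_power q).
Proof.
have cs : continuous s := continuous_comp_clamp (ltW P_gt0) (sinp_continuous q1).
exact: (continuousR_comp cs (continuous_powR_norm qB1)).
Qed.

Lemma sinp_power_itv x : 0 <= x <= P -> sinp_power q x = sinp q x `^ (q - 1).
Proof.
move=> x0P; rewrite /sinp_power clamp_id// ger0_norm//.
by have /andP[] := sinp_ge0_le q1 x0P.
Qed.

Lemma sinp_power_le0 x : x <= 0 -> sinp_power q x = 0.
Proof.
have s0 : sinp q 0 = 0 by rewrite -[in LHS](arcsinp0 q) sinp_arcsinp ?lexx ?ler01.
move=> x0; rewrite /sinp_power clampl// s0.
by rewrite normr0 powR0// gt_eqF.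
Qed.

Lemma sinp_power_le x y : x <= y -> sinp_power q x <= sinp_power q y.
Proof.
move=> xy; rewrite /sinp_power -/(s x) -/(s y) !ger0_norm//.
by apply: ge0_ler_powR; rewrite ?nnegrE ?(ltW qB1)// s_le.
Qed.

Lemma sinp_power_le_powR x : 0 <= x -> sinp_power q x <= x `^ (q - 1).
Proof.
move=> x0; have /andP[s0 sx] := s_ge0_le x0.
rewrite /sinp_power -/(s x) ger0_norm//.
by apply: ge0_ler_powR; rewrite ?nnegrE ?(ltW qB1).
Qed.

(** The derivative is [(q - 1) s ^ (q - 2) (1 - s ^ q) ^ (1 / q)] with [s = sinp q x] increasing in
    [x]. Both powers decrease in [s], the first one because [q < 2]. *)
Lemma sinp_power_increments a b l : 0 <= a -> a <= b -> 0 <= l ->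
  sinp_power q (b + l) - sinp_power q b <= sinp_power q (a + l) - sinp_power q a.
Proof.
apply: (@concave_increments _ _ (fun x => (q - 1) * sinp q x `^ (q - 2) *
  (1 - sinp q x `^ q) `^ q^-1) P).
- exact: sinp_power_continuous.
- by move=> x Px; rewrite /sinp_power !clampr// ltW.
- move=> x x0P; have [/andP[s0 s1] _] := sinp_itvoo q1 x0P.
  have d := @is_derive1_comp _ (@powR R ^~ (q - 1)) _ _ _ _
    (is_derive1_powR (q - 1) s0) (is_derive_sinp q1 x0P).
  have -> : q - 2 = q - 1 - 1 by ring.
  apply: near_eq_is_derive d.
  near=> t; rewrite /= sinp_power_itv//.
  have : t \in `]0, P[ by near: t; apply: near_in_itvoo; rewrite in_itv.
  by rewrite in_itv/= => /andP[t0 t1]; rewrite !ltW.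
- move=> x y x0 xy yP.
  have [/andP[sx0 sx1] _] := @sinp_itvoo _ q x q1 (introT andP (conj x0 (le_lt_trans xy yP))).
  have [/andP[sy0 sy1] _] := @sinp_itvoo _ q y q1 (introT andP (conj (lt_le_trans x0 xy) yP)).
  have sxy := sinp_le q1 (ltW x0) xy (ltW yP).
  apply: ler_pM.
  + by rewrite mulr_ge0 ?powR_ge0// ltW.
  + exact: powR_ge0.
  + rewrite ler_pM2l//.
    have -> : q - 2 = - (2 - q) by ring.
    rewrite !powRN lef_pV2 ?posrE ?powR_gt0//.
    by apply: ge0_ler_powR; rewrite ?nnegrE ?(ltW sx0) ?(ltW sy0) ?subr_ge0 ?(ltW q2).
  + have q0 : 0 < q by rewrite (lt_trans _ q1).
    have h : sinp q x `^ q <= sinp q y `^ q.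
      by apply: ge0_ler_powR; rewrite ?nnegrE ?(ltW sx0) ?(ltW sy0) ?(ltW q0).
    have h' : sinp q y `^ q < 1 by rewrite powR_lt1 ?(ltW sy0).
    apply: ge0_ler_powR; rewrite ?nnegrE ?invr_ge0 ?subr_ge0 ?lerD2l ?lerN2 ?(ltW q0)//.
    - exact: ltW.
    - exact: le_trans h (ltW h').
- by move=> x y _; exact: sinp_power_le.
Unshelve. all: by end_near. Qed.

End sinp_power.

(** * Integrals of functions that agree off finitely many points *)

Section eq_except.
Set Implicit Arguments.
Unset Strict Implicit.
Context {R : realType}.
Notation mu := (@lebesgue_measure R).
Implicit Types f g : R -> R.

(** Meant for the integrand containing [cosp], which is computed only off 0, 1/2 and 1.
    Measurability of [f] is inherited from [g] off the finite set [E], and any function is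
    measurable on a singleton. *)
Lemma eq_Rintegral_except f g (a b c : R) : continuous g ->
  (forall x, a < x < b -> x != c -> f x = g x) ->
  \int[mu]_(x in `[a, b]) f x = \int[mu]_(x in `[a, b]) g x.
Proof.
move=> cg fg; pose E : set R := [set a] `|` [set b] `|` [set c].
have mE : measurable E by do 2 apply: measurableU => //.
have fgE x : (`[a, b] `\` E) x -> f x = g x.
  rewrite /E /= in_itv/= => -[/andP[ax xb] /not_orP[/not_orP[xa xb'] xc]].
  apply: fg; last exact/eqP.
  by rewrite !lt_neqAle ax xb !andbT; apply/andP; split; apply/eqP => // /esym.
have mg : measurable_fun setT g := continuous_measurable_fun cg.
have mf : measurable_fun (`[a, b] : set R) f.
  suff : measurable_fun ((`[a, b] `\` E) `|` E) f.
    apply: measurable_funS; first by apply: measurableU => //; exact: measurableD.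
    by move=> x xab; have [xE|xE] := pselect (E x); [right|left].
  apply/measurable_funU => //; first exact: measurableD.
  split.
    apply: (@eq_measurable_fun _ _ _ _ _ g); last exact: measurable_funTS.
    by move=> x /set_mem /fgE.
  apply/measurable_funU => //; first exact: measurableU.
  split; last exact: measurable_fun_set1.
  by apply/measurable_funU => //; split; exact: measurable_fun_set1.
rewrite /Rintegral; congr fine; apply: ae_eq_integral => //.
- exact/measurable_EFinP.
- by apply/measurable_EFinP; exact: measurable_funTS.
exists E; split => //.
  apply: countable_lebesgue_measure0; apply: finite_set_countable.
  by rewrite !finite_setU; split; first split; exact: finite_set1.
move=> x /= /not_implyP[xab]; apply: contra_notP => nE.
by congr EFin; apply: fgE; split.
Qed.

End eq_except.

(** * The coefficient as a sine integral of the concave function *)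

Section cosp_coeff.
Set Implicit Arguments.
Unset Strict Implicit.
Context {R : realType}.
Notation mu := (@lebesgue_measure R).
Implicit Types p q : R.

(** [sinp_power] vanishes at nonpositive arguments, so a single term survives on each side of 1/2:
    the first by [cosp_dual], the second by reflection. The difference covers both halves with one
    continuous expression. *)
Lemma cosp_sinp_power p q x : 2 < p -> q = p / (p - 1) -> 0 < x < 1 -> x != 2^-1 ->
  cosp p (pip p * x) =
  sinp_power q (pip q * (2^-1 - x)) - sinp_power q (pip q * (x - 2^-1)).
Proof.
move=> p2 qE /andP[x0 x1] xn.
have p1 : 1 < p by lra.
have q1 : 1 < q by rewrite qE ltr_pdivlMr; lra.
have P0 := pip_gt0 p1; have Q0 := pip_gt0 q1; have dual := pip_dual p1 qE.
have in_half (P y : R) : 0 < P -> 0 < y -> y < 2^-1 -> 0 < P * y < P / 2.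
  by move=> P0' y0 y1; rewrite mulr_gt0//= ltr_pM2l.
have left y : 0 < y -> y < 2^-1 ->
    cosp p (pip p * y) = sinp_power q (pip q * (2^-1 - y)).
  move=> y0 y1; rewrite (cosp_dual p1 qE (in_half _ _ P0 y0 y1)).
  have -> : (p - 1) * (pip p / 2 - pip p * y) = pip q * (2^-1 - y).
    by rewrite dual; ring.
  rewrite sinp_power_itv//; apply/andP; split.
    by rewrite mulr_ge0 ?(ltW Q0)// subr_ge0 ltW.
  by rewrite ler_pM2l// gerBl ltW.
have nonpos y : y <= 0 -> sinp_power q (pip q * y) = 0.
  by move=> y0; rewrite sinp_power_le0// pmulr_rle0.
case: (ltgtP x 2^-1) xn => // xh _.
  by rewrite left// (nonpos (x - _)) ?subr0// subr_le0 ltW.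
have x'0 : 0 < 1 - x by rewrite subr_gt0.
have x'1 : 1 - x < 2^-1 by clear -xh; lra.
transitivity (cosp p (pip p - pip p * (1 - x))).
  by congr (cosp p _); rewrite mulrBr mulr1 subKr.
rewrite (cosp_reflect p1 (in_half _ _ P0 x'0 x'1)) (left _ x'0 x'1).
rewrite (nonpos (2^-1 - x)) ?subr_le0 ?ltW// sub0r.
by congr (- sinp_power q (_ * _)); field.
Qed.

(** The two halves of the integral, rescaled to [[0, j]], combine through [cos (A - B) - cos (A + B)
    = 2 sin A sin B] with [A = pi j / 2] and [B = pi t / 2]. *)
Lemma cosp_coeffE p q (j : nat) : 2 < p -> q = p / (p - 1) -> (0 < j)%N ->
  cosp_coeff p j = 2 / j%:R * sin (pi / 2 * j%:R) *
    \int[mu]_(t in `[0, j%:R])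
      (sinp_power q (pip q / (2 * j%:R) * t) * sin (pi / 2 * t)).
Proof.
move=> p2 qE j0; have q1 : 1 < q by rewrite qE ltr_pdivlMr; lra.
have J0 : 0 < j%:R :> R by rewrite ltr0n.
have Jn : j%:R != 0 :> R by rewrite gt_eqF.
set J : R := j%:R in J0 Jn *.
have cE := sinp_power_continuous q1.
pose f t := sinp_power q (pip q / (2 * J) * t).
have cfk (k c : R) : continuous (fun x => sinp_power q (k * x + c)).
  exact: (continuousR_comp (@continuous_affine R k c) cE).
have ccosk (k c : R) : continuous (fun x : R => cos (k * x + c)).
  exact: (continuousR_comp (@continuous_affine R k c) (@continuous_cos R)).
have csink (k c : R) : continuous (fun x : R => sin (k * x + c)).
  exact: (continuousR_comp (@continuous_affine R k c) (@continuous_sin R)).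
have cM (g h : R -> R) : continuous g -> continuous h -> continuous (fun x => g x * h x).
  by move=> cg ch x; apply: cvgM; [exact: cg|exact: ch].
pose L x := sinp_power q (pip q * (2^-1 - x)) * cos (J * pi * x).
pose M x := sinp_power q (pip q * (x - 2^-1)) * cos (J * pi * x).
have cL : continuous L.
  have -> : L = fun x => sinp_power q (- pip q * x + pip q / 2) * cos (J * pi * x + 0).
    by apply/funext => x; rewrite /L addr0; congr (sinp_power q _ * _); ring.
  exact: cM.
have cMM : continuous M.
  have -> : M = fun x => sinp_power q (pip q * x - pip q / 2) * cos (J * pi * x + 0).
    by apply/funext => x; rewrite /M addr0; congr (sinp_power q _ * _); ring.
  exact: cM.
have cLM : continuous (fun x => L x - M x).
  by move=> x; apply: cvgB; [exact: cL|exact: cMM].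
rewrite /cosp_coeff (@eq_Rintegral_except _ _ (fun x => L x - M x) _ _ 2^-1)//; last first.
  by move=> x x01 xn; rewrite (cosp_sinp_power p2 qE x01 xn) mulrBl.
have k0 : 0 < (2 * J)^-1 by rewrite invr_gt0; lra.
rewrite (@continuous_Rintegral_cat _ _ _ 2^-1)//; [|lra..].
(* [M] vanishes left of 1/2 and [L] right of it; the substitutions are [x = 1/2 - t / (2 J)] here
   and [x = 1/2 + t / (2 J)] in [rightE]. *)
have leftE : \int[mu]_(x in `[0, 2^-1]) (L x - M x) =
    (2 * J)^-1 * \int[mu]_(t in `[0, J]) (f t * cos (J * pi * (2^-1 - (2 * J)^-1 * t))).
  transitivity (\int[mu]_(x in `[0, 2^-1]) L x).
    apply: eq_Rintegral => x; rewrite inE/= in_itv/= => /andP[_ xh].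
    rewrite /M sinp_power_le0 ?mul0r ?subr0//.
    by rewrite pmulr_rle0 ?pip_gt0// subr_le0.
  have -> : `[0, 2^-1] = `[2^-1 - (2 * J)^-1 * J, 2^-1 - (2 * J)^-1 * 0] :> interval R.
    by congr `[_, _]; field.
  rewrite (@continuous_Rintegral_reflect _ L 0 J 2^-1 _ cL k0 (ltW J0)).
  apply: (congr1 ( *%R (2 * J)^-1)); apply: eq_Rintegral => t _; rewrite /L /f.
  by congr (sinp_power q _ * _); field.
have rightE : \int[mu]_(x in `[2^-1, 1]) (L x - M x) =
    - ((2 * J)^-1 * \int[mu]_(t in `[0, J]) (f t * cos (J * pi * ((2 * J)^-1 * t + 2^-1)))).
  transitivity (\int[mu]_(x in `[2^-1, 1]) (-1 * M x)).
    apply: eq_Rintegral => x; rewrite inE/= in_itv/= => /andP[xh _].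
    rewrite /L sinp_power_le0 ?mul0r ?sub0r ?mulN1r//.
    by rewrite pmulr_rle0 ?pip_gt0// subr_le0.
  rewrite RintegralZl//; last exact: continuous_integrable.
  rewrite mulN1r; congr (- _).
  have -> : `[2^-1, 1] = `[(2 * J)^-1 * 0 + 2^-1, (2 * J)^-1 * J + 2^-1] :> interval R.
    by congr `[_, _]; field.
  rewrite (@continuous_Rintegral_affine _ M 0 J 2^-1 _ cMM k0 (ltW J0)).
  apply: (congr1 ( *%R (2 * J)^-1)); apply: eq_Rintegral => t _; rewrite /M /f.
  by congr (sinp_power q _ * _); field.
have cf : continuous f.
  have -> : f = fun t => sinp_power q (pip q / (2 * J) * t + 0).
    by apply/funext => t; rewrite addr0.
  exact: cfk.
have cl : continuous (fun t => f t * cos (J * pi * (2^-1 - (2 * J)^-1 * t))).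
  have -> : (fun t => f t * cos (J * pi * (2^-1 - (2 * J)^-1 * t))) =
      fun t => f t * cos (- (pi / 2) * t + pi / 2 * J).
    by apply/funext => t; congr (_ * cos _); field.
  exact: cM.
have cr : continuous (fun t => f t * cos (J * pi * ((2 * J)^-1 * t + 2^-1))).
  have -> : (fun t => f t * cos (J * pi * ((2 * J)^-1 * t + 2^-1))) =
      fun t => f t * cos (pi / 2 * t + pi / 2 * J).
    by apply/funext => t; congr (_ * cos _); field.
  exact: cM.
rewrite leftE rightE -mulrBr -RintegralB//; last 2 first.
  exact: continuous_integrable.
  exact: continuous_integrable.
have -> : 2 / J * sin (pi / 2 * J) * \int[mu]_(t in `[0, J]) (f t * sin (pi / 2 * t)) =
    2 * ((2 * J)^-1 * \int[mu]_(t in `[0, J]) (2 * sin (pi / 2 * J) * (f t * sin (pi / 2 * t)))).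
  rewrite RintegralZl//; first by field.
  apply: continuous_integrable.
  have -> : (fun t => f t * sin (pi / 2 * t)) = (fun t => f t * sin (pi / 2 * t + 0)).
    by apply/funext => t; rewrite addr0.
  exact: cM.
congr (_ * (_ * _)); apply: eq_Rintegral => t _.
have -> : J * pi * (2^-1 - (2 * J)^-1 * t) = pi / 2 * J - pi / 2 * t by field.
have -> : J * pi * ((2 * J)^-1 * t + 2^-1) = pi / 2 * J + pi / 2 * t by field.
by rewrite cosB cosD; ring.
Qed.

End cosp_coeff.

(** * Estimate of the integral over the first quarter-period *)

Section integral_estimates.
Set Implicit Arguments.
Unset Strict Implicit.
Context {R : realType}.
Notation mu := (@lebesgue_measure R).

(** [cos 1] is positive while [cos (pi / 2) = 0]. For odd [j], the strict inequality of the theorem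
    comes from here. *)
Lemma pi_gt2 : 2 < pi :> R.
Proof.
rewrite lt_neqAle pi_ge2 andbT; apply/eqP => pi2.
by have := cos1_gt0 R; rewrite -[1](@divff R 2)// {1}pi2 cos_pihalf ltxx.
Qed.

(** Young's inequality for the product of [v ^ r] and 1, with exponents [1 / r] and
    [1 / (1 - r)]. *)
Lemma powR_le_affine (v r : R) : 0 <= v -> 0 < r < 1 -> v `^ r <= r * v + (1 - r).
Proof.
move=> v0 /andP[r0 r1].
have := @conjugate_powR R (v `^ r) 1 r^-1 (1 - r)^-1 (powR_ge0 _ _) ler01.
rewrite !invr_gt0 !invrK mulr1 -powRrM divff ?gt_eqF// powRr1// powR1 mul1r mulrC.
by apply=> //; [rewrite subr_gt0|ring].
Qed.

Lemma Rintegral_affine_sin (a b : R) :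
  \int[mu]_(v in `[0, 1]) ((a * v + b) * sin (pi / 2 * v)) =
  4 / pi ^+ 2 * a + 2 / pi * b.
Proof.
have pi0 : pi != 0 :> R by rewrite gt_eqF ?pi_gt0.
(* Antiderivative found by parts: the sine is integrated to [- (2 / pi) cos (pi v / 2)], and the
   first term of [G] integrates what remains. *)
pose G (v : R) := 4 / pi ^+ 2 * a * sin (pi / 2 * v) -
             (2 / pi) * ((a * v + b) * cos (pi / 2 * v)).
have dG (v : R) : is_derive v 1 G ((a * v + b) * sin (pi / 2 * v)).
  have d1 : is_derive v 1 (fun v : R => pi / 2 * v) (pi / 2).
    by apply: is_derive_eq; rewrite /GRing.scale/= mulr1.
  have d2 := @is_derive1_comp R sin (fun v => pi / 2 * v) v _ _ (is_derive_sin _) d1.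
  have d3 := @is_derive1_comp R cos (fun v => pi / 2 * v) v _ _ (is_derive_cos _) d1.
  have d4 : is_derive v 1 (fun v : R => a * v + b) a.
    by apply: is_derive_eq; rewrite /GRing.scale/= mulr1 addr0.
  have d5 := is_deriveB (is_deriveZ (4 / pi ^+ 2 * a) d2)
    (is_deriveZ (2 / pi) (is_deriveM d4 d3)).
  apply: (is_derive_eq d5).
  rewrite /GRing.scale/=; move: (sin _) (cos _) => S C.
  by move: pi0; move: (pi : R) => c c0; field.
have cG : continuous G.
  by move=> v; apply/differentiable_continuous/derivable1_diffP; case: (dG v).
have cg : continuous (fun v : R => (a * v + b) * sin (pi / 2 * v)).
  have cs := continuousR_comp (@continuous_affine R (pi / 2) 0) (@continuous_sin R).
  have -> : (fun v : R => (a * v + b) * sin (pi / 2 * v)) =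
      fun v => (a * v + b) * sin (pi / 2 * v + 0).
    by apply/funext => v; rewrite addr0.
  by move=> v; apply: cvgM; [exact: continuous_affine|exact: cs].
rewrite /Rintegral (@continuous_FTC2 R _ G 0 1 ltr01 (continuous_subspaceT cg)).
- rewrite /= /G !mulr0 mulr1 sin0 cos0 sin_pihalf cos_pihalf.
  by move: pi0; move: (pi : R) => c c0; field.
- split; first by move=> v _; case: (dG v).
  + exact: cvg_at_right_filter (cG _).
  + exact: cvg_at_left_filter (cG _).
- by move=> v _; rewrite derive1E; apply: derive_val.
Qed.

(** By sin_q x <= x, the first factor is at most [(pip q / 2) ^ (q - 1) j ^ (- (q - 1)) v ^ (q -
    1)]. The first power is at most its base, since [pip q / 2 >= 1] and [q - 1 <= 1]; the last is
    bounded by the affine function of [powR_le_affine]. *)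
Lemma sinp_power_integral_le (q : R) (j : nat) : 1 < q -> q < 2 -> (0 < j)%N ->
  \int[mu]_(v in `[0, 1])
    (sinp_power q (pip q / (2 * j%:R) * v) * sin (pi / 2 * v)) <=
  pip q / 2 * j%:R `^ (- (q - 1)) *
    (4 / pi ^+ 2 * (q - 1) + 2 / pi * (2 - q)).
Proof.
move=> q1 q2 j0; have J0 : 0 < j%:R :> R by rewrite ltr0n.
set J : R := j%:R in J0 *.
have cE := sinp_power_continuous q1.
have cs : continuous (fun v : R => sin (pi / 2 * v)).
  have -> : (fun v : R => sin (pi / 2 * v)) = fun v => sin (pi / 2 * v + 0).
    by apply/funext => v; rewrite addr0.
  exact: (continuousR_comp (@continuous_affine R (pi / 2) 0) (@continuous_sin R)).
have cf : continuous (fun v => sinp_power q (pip q / (2 * J) * v)).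
  have -> : (fun v => sinp_power q (pip q / (2 * J) * v)) =
      fun v => sinp_power q (pip q / (2 * J) * v + 0).
    by apply/funext => t; rewrite addr0.
  exact: (continuousR_comp (@continuous_affine R (pip q / (2 * J)) 0) cE).
have cg : continuous (fun v : R => ((q - 1) * v + (2 - q)) * sin (pi / 2 * v)).
  by move=> v; apply: cvgM; [exact: continuous_affine|exact: cs].
rewrite -Rintegral_affine_sin -RintegralZl//; last exact: continuous_integrable.
apply: le_Rintegral => //.
- apply: continuous_integrable => v.
  by apply: cvgM; [exact: cf|exact: cs].
- apply: continuous_integrable => v.
  by apply: cvgMr; exact: cg.
move=> v /=; rewrite in_itv/= => /andP[v0 v1].
have s0 : 0 <= sin (pi / 2 * v).
  apply: sin_ge0_pi; have := pi_gt0 R => pi0.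
  by apply/andP; split; nra.
rewrite [leRHS]mulrA ler_wpM2r//.
have Q1 : 1 <= pip q / 2 by have := pip_ge2 q1; rewrite ler_pdivlMr// mul1r.
have Q0 : 0 <= pip q / 2 := le_trans ler01 Q1.
have kE : pip q / (2 * J) * v = pip q / 2 * (J^-1 * v) by rewrite invfM; ring.
have JV0 : 0 <= J^-1 by rewrite invr_ge0 ltW.
have Jv0 : 0 <= J^-1 * v := mulr_ge0 JV0 v0.
rewrite kE; apply: le_trans (sinp_power_le_powR q1 (mulr_ge0 Q0 Jv0)) _.
rewrite (powRM _ Q0 Jv0) (powRM _ JV0 v0).
rewrite -(powR_inv1 (ltW J0)) -powRrM mulN1r -mulrA.
apply: ler_pM; rewrite ?powR_ge0 ?mulr_ge0 ?powR_ge0//.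
  by apply: ler1_powR => //; rewrite lerBlDr ltW.
rewrite ler_wpM2l ?powR_ge0//.
have := @powR_le_affine v (q - 1) v0.
have -> : 1 - (q - 1) = 2 - q by ring.
by apply; rewrite subr_gt0 q1 ltrBlDr.
Qed.

End integral_estimates.

(** * The bound on the coefficients *)

Theorem lemma7 (R : realType) (p p' : R) (hp : 2 < p) (hp' : p' = p / (p - 1))
    (j : nat) (hj : (3 <= j)%N) :
  `|cosp_coeff p j| <
    2 * pip p' / (pi ^+ 2 * (p - 1)) * (2 + pi ^+ 2 / 2 * (p - 2)) *
    j%:R `^ (- p').
Proof.
have pB0 : 0 < p - 1 by rewrite subr_gt0 (lt_trans _ hp)// ltr1n.
have p'1 : 1 < p' by rewrite hp' ltr_pdivlMr// mul1r gtrBl.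
have p'2 : p' < 2 by rewrite hp' ltr_pdivrMr//; clear -hp; lra.
have j0 : (0 < j)%N by exact: leq_trans hj.
have J0 : 0 < j%:R :> R by rewrite ltr0n.
have pi0 : 0 < pi :> R := pi_gt0 R.
have Q0 : 0 < pip p' := pip_gt0 p'1.
(* The factor [1 / j] matches the prefactor in [cosp_coeffE], the other power the bound on the
   integral. *)
have JE : j%:R `^ (- p') = j%:R^-1 * j%:R `^ (- (p' - 1)) :> R.
  have -> : - p' = -1 + - (p' - 1) by ring.
  by rewrite powRD ?(gt_eqF J0) ?implybT// powR_inv1// ltW.
have Jp : 0 < j%:R `^ (- (p' - 1)) :> R by exact: powR_gt0.
have I0 := sinp_power_integral_le p'1 p'2 j0.
rewrite (cosp_coeffE hp hp' j0) JE.
(* Here [p' - 1 = 1 / (p - 1)] and [2 - p' = (p - 2) / (p - 1)]. *)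
have rhsE : 2 * pip p' / (pi ^+ 2 * (p - 1)) * (2 + pi ^+ 2 / 2 * (p - 2)) *
    (j%:R^-1 * j%:R `^ (- (p' - 1))) =
    2 / j%:R * (pip p' / 2 * j%:R `^ (- (p' - 1)) *
      (4 / pi ^+ 2 * (p' - 1) + (2 - p'))).
  move: (pip _) (_ `^ _) => Q X; rewrite hp'.
  move: pi0 J0; move: (pi : R) (j%:R : R) => c J c0 J0.
  by field; rewrite !gt_eqF.
rewrite rhsE.
have K0 : 0 < pip p' / 2 * j%:R `^ (- (p' - 1)) by rewrite mulr_gt0// divr_gt0.
have rhs_gt : pip p' / 2 * j%:R `^ (- (p' - 1)) *
      (4 / pi ^+ 2 * (p' - 1) + 2 / pi * (2 - p')) <
    pip p' / 2 * j%:R `^ (- (p' - 1)) * (4 / pi ^+ 2 * (p' - 1) + (2 - p')).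
  rewrite (ltr_pM2l K0) ltrD2l gtr_pMl ?subr_gt0//.
  by rewrite ltr_pdivrMr// mul1r pi_gt2.
rewrite 2!normrM (ger0_norm (_ : 0 <= 2 / j%:R)) ?divr_ge0//.
rewrite -mulrA ltr_pM2l ?divr_gt0//.
(* For even [j] the coefficient is 0, since [pi j / 2] is a multiple of [pi], and the bound is
   positive. *)
have [jodd|jeven] := boolP (odd j); last first.
  have jE : j = (j./2 * 2)%N by rewrite muln2 even_halfK.
  have -> : sin (pi / 2 * j%:R) = 0 :> R.
    have -> : pi / 2 * j%:R = 0 + pi *+ j./2 :> R.
      rewrite {1}jE natrM add0r -[RHS]mulr_natr.
      by move: (pi : R) => c; field.
    by rewrite (alternatingn (@sinDpi R)) sin0 mulr0.
  rewrite normr0 mul0r (mulr_gt0 K0)//.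
  by rewrite addr_gt0 ?subr_gt0// mulr_gt0 ?subr_gt0// divr_gt0// exprn_gt0.
have cf : continuous (fun t : R => sinp_power p' (pip p' / (2 * j%:R) * t)).
  have -> : (fun t => sinp_power p' (pip p' / (2 * j%:R) * t)) =
      fun t => sinp_power p' (pip p' / (2 * j%:R) * t + 0).
    by apply/funext => t; rewrite addr0.
  exact: (continuousR_comp (@continuous_affine R (pip p' / (2 * j%:R)) 0)
    (sinp_power_continuous p'1)).
have k0 : 0 <= pip p' / (2 * j%:R) by apply: divr_ge0; [exact: ltW|rewrite mulr_ge0].
(* For odd [j] the segment [[0, j]] ends at an odd integer, as [sine_integral_le] requires with
   [m = j./2]. *)
have jE : j%:R = j./2%:R * 2 + 1 :> R.
  by rewrite -natrM muln2 natr1 -[in LHS](odd_double_half j) jodd add1n.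
have := @sine_integral_le R _ cf _ _ _ j./2; rewrite -jE => osc.
apply: le_lt_trans rhs_gt; apply: le_trans I0.
rewrite -[leRHS]mul1r; apply: ler_pM => //.
  by rewrite ler_norml sin_geN1 sin_le1.
apply: osc.
- by rewrite mulr0 sinp_power_le0.
- by move=> a b _ ab; apply: sinp_power_le => //; rewrite ler_wpM2l.
- move=> a b l a0 ab l0; rewrite !mulrDr.
  apply: sinp_power_increments => //.
  + exact: mulr_ge0.
  + exact: ler_wpM2l.
  + exact: mulr_ge0.
Qed.
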